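(* Let $I=(n,m,X_1,\ldots,X_m,\tau_0)$ be an instance in which every $X_j\subseteq[n]$ is a set of consecutive integers, and suppose $I$ is a YES-instance of V2-WPPSG, i.e., there exist $\tau_1,\ldots,\tau_m\in\mathcal{S}_n$ with $\tau_m=\mathrm{id}$ and $\tau_{j-1}\xrightarrow{X_j}\tau_j$ for all $j\in[m]$. Then the sorting strategy is successful on $I$: the permutation $\tau_m$ it produces equals $\mathrm{id}=(1,\ldots,n)$.
   Context: $[n]=\{1,\ldots,n\}$; $\mathcal{S}_n$ is the symmetric group on $[n]$, the image of $i$ under $\tau$ is $i\tau$, and $\tau$ is identified with $(1\tau,\ldots,n\tau)$. For $X\subseteq[n]$, $\tau'\xrightarrow{X}\tau$ means $i\tau=i\tau'$ for all $i\in[n]\setminus X$; $\tau$ is $X$-sorted if $i\tau<j\tau$ for all $i<j$ in $X$ (each $\xrightarrow{X}$-class has exactly one $X$-sorted member). The sorting strategy applied to $\tau_0$ and $X_1,\ldots,X_m$ defines, for $j=1,\ldots,m$, $\tau_j$ as the unique $X_j$-sorted permutation coinciding with $\tau_{j-1}$ outside $X_j$; it is successful if the final $\tau_m$ is the identity. *)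

(* Defs.v *)
From mathcomp Require Import all_boot all_fingroup zify.

Set Implicit Arguments.
Unset Strict Implicit.
Unset Printing Implicit Defensive.

(* The ground set [n] = {1, ..., n} is represented by 'I_n = {0, ..., n.-1};
   the image of i under tau is [tau i], and the identity of 'S_n is [1%g]. *)

(* Arrow relation: tau coincides with tau' outside X. *)
Definition coincide_off n (X : {set 'I_n}) (tau' tau : 'S_n) : bool :=
  [forall i, (i \notin X) ==> (tau i == tau' i)].

Definition sorted_on n (X : {set 'I_n}) (tau : 'S_n) : bool :=
  [forall i in X, forall j in X, (i < j) ==> (tau i < tau j)].

Definition consecutive n (X : {set 'I_n}) : Prop :=
  exists a b : nat, X = [set i : 'I_n | a <= i <= b].

(* The default value tau of the choice is never used: see [sort_onP] and
   [sort_on_uniq] below. *)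
Definition sort_on n (X : {set 'I_n}) (tau : 'S_n) : 'S_n :=
  odflt tau [pick s | coincide_off X tau s && sorted_on X s].

Definition sorting_strategy n (tau0 : 'S_n) (Xs : seq {set 'I_n}) : 'S_n :=
  foldl (fun tau X => sort_on X tau) tau0 Xs.

(* Only the values tau 0, ..., tau m matter. The set X_j of the paper is
   [tnth X j] with j counted from 0. *)
Definition yes_instance n m (X : m.-tuple {set 'I_n}) (tau0 : 'S_n) : Prop :=
  exists tau : nat -> 'S_n,
    [/\ tau 0 = tau0,
        tau m = 1%g
      & forall j : 'I_m, coincide_off (tnth X j) (tau j) (tau j.+1)].

Lemma coincide_offP n (X : {set 'I_n}) (s t : 'S_n) :
  reflect (forall i, i \notin X -> t i = s i) (coincide_off X s t).
Proof.
apply: (iffP forallP) => [h i iX|h i]; first by have /implyP/(_ iX)/eqP := h i.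
by apply/implyP => /h ->.
Qed.

Lemma sorted_onP n (X : {set 'I_n}) (t : 'S_n) :
  reflect {in X &, forall i j : 'I_n, i < j -> t i < t j} (sorted_on X t).
Proof.
apply: (iffP forall_inP) => [h i j iX jX|h i iX].
  by have /forall_inP/(_ j jX)/implyP := h i iX.
by apply/forall_inP => j jX; apply/implyP; apply: h.
Qed.

Lemma sorted_on_exists n (X : {set 'I_n}) (t : 'S_n) :
  exists s, coincide_off X t s && sorted_on X s.
Proof.
have t0 : coincide_off X t t by apply/coincide_offP.
pose F (s : 'S_n) := \sum_(i < n) i * s i.
case: (@arg_maxnP _ t (coincide_off X t) F t0) => s cs smax.
exists s; rewrite cs; apply/sorted_onP => i j iX jX ij.
rewrite ltnNge; apply/negP => ji.
have nij : i != j by rewrite neq_ltn ij.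
have sji : s j < s i.
  by rewrite ltn_neqAle ji andbT (inj_eq val_inj) (inj_eq perm_inj) eq_sym.
have /smax : coincide_off X t (tperm i j * s)%g.
  apply/coincide_offP => k kX; rewrite permM tpermD ?(coincide_offP _ _ _ cs) //.
    by apply: contraNneq kX => <-.
  by apply: contraNneq kX => <-.
have FE u : F u = i * u i + (j * u j + \sum_(k < n | (k != i) && (k != j)) k * u k).
  by rewrite /F (bigD1 i) //=; congr (_ + _); rewrite (bigD1 j) // eq_sym.
rewrite !FE !permM tpermL tpermR.
have -> : \sum_(k < n | (k != i) && (k != j)) k * (tperm i j * s)%g k =
          \sum_(k < n | (k != i) && (k != j)) k * s k.
  by apply: eq_bigr => k /andP[ki kj]; rewrite permM tpermD // eq_sym.
by nia.
Qed.

Lemma sorted_on_unique n (X : {set 'I_n}) (t s1 s2 : 'S_n) :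
  coincide_off X t s1 -> sorted_on X s1 ->
  coincide_off X t s2 -> sorted_on X s2 -> s1 = s2.
Proof.
move=> /coincide_offP c1 /sorted_onP o1 /coincide_offP c2 /sorted_onP o2.
have half (u v : 'S_n) (i : 'I_n) : (forall k, k \notin X -> u k = v k) ->
    {in X &, forall i j : 'I_n, i < j -> v i < v j} ->
    (forall k : 'I_n, k < i -> u k = v k) -> i \in X -> ~ u i < v i.
  move=> uv ov low iX lt_uv.
  pose k := (v^-1)%g (u i); have vk : v k = u i by rewrite permKV.
  have nki : k != i by apply: contraTneq lt_uv => ki; rewrite -vk ki ltnn.
  have kX : k \in X.
    apply: contraNT nki => kX; apply/eqP/(@perm_inj _ u).
    by rewrite uv.
  have [ki|ik|/val_inj/eqP] := ltngtP k i; last by rewrite (negbTE nki).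
    by move/eqP: nki; apply; apply/(@perm_inj _ u); rewrite low.
  by have := ov _ _ iX kX ik; rewrite vk; lia.
have eqoff k : k \notin X -> s1 k = s2 k by move=> kX; rewrite c1 ?c2.
suff eqm m (i : 'I_n) : i < m -> s1 i = s2 i by apply/permP => i; apply: (eqm n).
elim: m i => // m IH i im.
have low (k : 'I_n) : k < i -> s1 k = s2 k by move=> ki; apply: IH; lia.
have [iX|/eqoff //] := boolP (i \in X).
have [lt|lt|/val_inj //] := ltngtP (s1 i) (s2 i).
  by case: (half s1 s2 i).
have := half s2 s1 i (fun k h => esym (eqoff k h)) o1 (fun k h => esym (low k h)) iX; by [].
Qed.

Lemma sort_onP n (X : {set 'I_n}) (t : 'S_n) :
  coincide_off X t (sort_on X t) /\ sorted_on X (sort_on X t).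
Proof.
rewrite /sort_on; case: pickP => [s /andP //|h].
by have [s] := sorted_on_exists X t; rewrite h.
Qed.

Lemma sort_on_uniq n (X : {set 'I_n}) (t s : 'S_n) :
  coincide_off X t s -> sorted_on X s -> s = sort_on X t.
Proof.
by have [c o] := sort_onP X t => cs os; apply: (sorted_on_unique cs os c o).
Qed.

(* Main.v *)
Require Import Defs.
From mathcomp Require Import all_boot all_fingroup zify.

Set Implicit Arguments.
Unset Strict Implicit.
Unset Printing Implicit Defensive.

(** Let [rank s p q] be the number of positions [i < p] with [s i < q].  Order
    permutations by pointwise comparison of ranks, the identity having the
    largest ones (this is the Bruhat order, reversed).  A move on an interval
    [a, b] changes [rank s p q] only for [a < p <= b], and there
      [rank s p q <= minn (rank s a q + (p - a)) (rank s b.+1 q)],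
    with equality when [s] is sorted on the interval.  Hence sorting preserves
    domination over any legal sequence of moves; if that sequence ends at the
    identity, so does the sorting strategy. *)

Definition rank n (s : 'S_n) (p q : nat) : nat :=
  #|[set i : 'I_n | (i < p) && (s i < q)]|.

Definition rank_dominates n (s t : 'S_n) : Prop :=
  forall p q, rank t p q <= rank s p q.

Lemma card_perm_lt n (s : 'S_n) (q : nat) :
  #|[set i | s i < q]| = #|[set i : 'I_n | i < q]|.
Proof.
rewrite -[RHS](card_imset _ (@perm_inj _ (s^-1)%g)); apply: eq_card => i.
apply/idP/imsetP => [|[j]]; rewrite ?inE => h.
  by exists (s i); rewrite ?inE ?permK.
by move=> ->; rewrite permKV.
Qed.

Lemma rank_compl n (s : 'S_n) (p q : nat) :
  rank s p q + #|[set i : 'I_n | (p <= i) && (s i < q)]| =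
  #|[set i : 'I_n | i < q]|.
Proof.
rewrite -(card_perm_lt s) -[RHS](cardsID [set i : 'I_n | i < p]).
by congr (_ + _); apply: eq_card => i; rewrite !inE; lia.
Qed.

Lemma leq_rank n (s : 'S_n) (p1 p2 q : nat) :
  p1 <= p2 -> rank s p1 q <= rank s p2 q.
Proof.
by move=> le12; apply/subset_leq_card/subsetP => i; rewrite !inE; lia.
Qed.

Lemma rank_split n (s : 'S_n) (a p q : nat) : a <= p ->
  rank s p q = rank s a q + #|[set i : 'I_n | (a <= i < p) && (s i < q)]|.
Proof.
move=> ap; rewrite -[LHS](cardsID [set i : 'I_n | i < a]).
by congr (_ + _); apply: eq_card => i; rewrite !inE; lia.
Qed.

(** For [p <= a] every position below [p] lies off [X]. For [b < p] every position from [p] on does,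
    and [rank_compl] turns the count there into [rank]. *)
Lemma rank_coincide n (X : {set 'I_n}) (t s : 'S_n) (a b p q : nat) :
  X = [set i : 'I_n | a <= i <= b] -> coincide_off X t s ->
  (p <= a) || (b < p) -> rank s p q = rank t p q.
Proof.
move=> XE /coincide_offP st /orP[pa|bp].
  apply: eq_card => i; rewrite !inE; case: (ltnP i p) => //= ip.
  have iX : i \notin X by rewrite XE inE; lia.
  by rewrite st.
apply: (@addIn #|[set i : 'I_n | (p <= i) && (s i < q)]|).
rewrite rank_compl -(rank_compl t p); congr (_ + _).
apply: eq_card => i; rewrite !inE; case: (leqP p i) => //= pi.
have iX : i \notin X by rewrite XE inE; lia.
by rewrite st.
Qed.

(** If some position in [p, b] has a value below [q], sortedness puts all values on [a, p) below
    [q], so [rank s] has grown since [a] as much as possible. Otherwise [rank s] is constant from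
    [p] to [b.+1], and [rank t] is monotone. *)
Lemma sorted_rank n (X : {set 'I_n}) (s t : 'S_n) (a b p q : nat) :
  X = [set i : 'I_n | a <= i <= b] -> sorted_on X s -> a < p <= b ->
  rank t a q <= rank s a q -> rank t b.+1 q <= rank s b.+1 q ->
  rank t p q <= rank s p q.
Proof.
move=> XE /sorted_onP so /andP[ap pb] lea leb.
case: (pickP [pred i : 'I_n | (p <= i <= b) && (s i < q)]) => [i|none].
  move=> /andP[/andP[pi ib] siq].
  rewrite (rank_split s q (ltnW ap)) (rank_split t q (ltnW ap)) leq_add //.
  apply/subset_leq_card/subsetP => j; rewrite !inE => /andP[/andP[aj jp] _].
  rewrite aj jp /=; apply: leq_trans siq; rewrite ltnS ltnW //.
  by apply: so; rewrite ?XE ?inE; lia.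
have <- : rank s b.+1 q = rank s p q.
  apply: eq_card => i; rewrite !inE; have := none i; rewrite inE.
  by case: (s i < q); lia.
by apply: leq_trans leb; apply: leq_rank; lia.
Qed.

Lemma sort_on_dominates n (X : {set 'I_n}) (s t t' : 'S_n) :
  consecutive X -> rank_dominates s t -> coincide_off X t t' ->
  rank_dominates (sort_on X s) t'.
Proof.
move=> [a [b XE]] dom tt'; have [cs so] := sort_onP X s.
(* Neither move changes these ranks; the range contains [a] and [b.+1], the two endpoints that
   [sorted_rank] needs. *)
have out p q : (p <= a) || (b < p) -> rank t' p q <= rank (sort_on X s) p q.
  by move=> h; rewrite (rank_coincide q XE tt' h) (rank_coincide q XE cs h) dom.
move=> p q; case: (boolP ((p <= a) || (b < p))) => [/out //|h].
by apply: (sorted_rank XE so); [lia | apply: out; lia | apply: out; lia].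
Qed.

Lemma sorting_strategy_dominates n (Xs : seq {set 'I_n}) (t : nat -> 'S_n)
    (s : 'S_n) :
  (forall j, j < size Xs -> consecutive (nth set0 Xs j)) ->
  (forall j, j < size Xs -> coincide_off (nth set0 Xs j) (t j) (t j.+1)) ->
  rank_dominates s (t 0) ->
  rank_dominates (sorting_strategy s Xs) (t (size Xs)).
Proof.
elim: Xs t s => [//|X Xs IH] t s hX ht dom /=.
apply: (IH (fun j => t j.+1)) => [j h|j h|]; [exact: (hX j.+1)|exact: (ht j.+1)|].
exact: (sort_on_dominates (hX 0 _) dom (ht 0 _)).
Qed.

Lemma perm_le_id n (s : 'S_n) : (forall i, s i <= i) -> s = 1%g.
Proof.
move=> le_s.
suff fix_lt m (i : 'I_n) : i < m -> s i = i.
  by apply/permP => i; rewrite perm1 (fix_lt n).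
elim: m i => // m IH i im.
case: (ltngtP (s i) i) (le_s i) => [lt _|//|/val_inj //].
(* As [s i < i], induction gives [s (s i) = s i], and injectivity applies. *)
by apply: (@perm_inj _ s); apply: IH; lia.
Qed.

Lemma rank_dominates1 n (s : 'S_n) : rank_dominates s 1%g -> s = 1%g.
Proof.
move=> dom; apply: perm_le_id => i.
(* Take [p = q = i.+1]: the identity's set is all of [0, i], so domination forces equality, and
   membership of [i] reads [s i <= i]. *)
have sub : [set j : 'I_n | (j < i.+1) && (s j < i.+1)] \subset
           [set j : 'I_n | (j < i.+1) && ((1%g : 'S_n) j < i.+1)].
  by apply/subsetP => j; rewrite !inE perm1 => /andP[->].
have /eqP/setP/(_ i) :
    [set j : 'I_n | (j < i.+1) && (s j < i.+1)] ==
    [set j : 'I_n | (j < i.+1) && ((1%g : 'S_n) j < i.+1)].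
  by rewrite eqEcard sub; apply: dom.
by rewrite !inE perm1 ltnSn.
Qed.

Theorem theorem3p12 (n m : nat) (X : m.-tuple {set 'I_n}) (tau0 : 'S_n)
    (hX : forall j : 'I_m, consecutive (tnth X j))
    (hyes : yes_instance X tau0) :
  sorting_strategy tau0 X = 1%g.
Proof.
case: hyes => tau [t0 tm ht]; apply: rank_dominates1; rewrite -tm.
rewrite -{2}(size_tuple X).
apply: sorting_strategy_dominates => [j|j|]; last by rewrite t0.
- by rewrite size_tuple => jm; have := hX (Ordinal jm); rewrite (tnth_nth set0).
- by rewrite size_tuple => jm; have := ht (Ordinal jm); rewrite (tnth_nth set0).
Qed.
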